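(* Let $G$ be an $\alpha_1$-metric graph and $v$ an arbitrary vertex of $G$. If (i) $e(v)>rad(G)+1$, or (ii) $e(v)=rad(G)+1$ and $diam(G)<2rad(G)-1$, then there exists a neighbor $w$ of $v$ with $e(w)<e(v)$. Moreover, if $e(v)=rad(G)+k$ for some integer $k>0$, then $d(v,C(G))\le k+1$.
   Context: All graphs are finite, connected, unweighted, undirected, simple; $d(u,v)$ is the shortest-path distance. $I(u,v)=\{x: d(u,x)+d(x,v)=d(u,v)\}$. A graph is $\alpha_1$-metric if for all vertices $u,v,w,x$: whenever $v\in I(u,w)$, $w\in I(v,x)$ and $v,w$ are adjacent, then $d(u,x)\ge d(u,v)+d(v,x)-1$. $e(v)=\max_u d(u,v)$, $rad(G)=\min_v e(v)$, $diam(G)=\max_v e(v)$, $C(G)=\{v:e(v)=rad(G)\}$, and $d(v,S)=\min_{s\in S}d(v,s)$. *)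

(* Defs.v *)
From mathcomp Require Import all_boot.
Set Implicit Arguments. Unset Strict Implicit. Unset Printing Implicit Defensive.

Section Graph.
Variable T : finType.
Variable e : rel T.

Definition simple_graph : Prop := symmetric e /\ irreflexive e.
Definition connected_graph : Prop := forall u v : T, connect e u v.

Definition walk_len (u v : T) (n : nat) : bool :=
  [exists p : n.-tuple T, path e u p && (last u p == v)].

(* shortest-path distance (for connected graphs every distance is < #|T|) *)
Definition dist (u v : T) : nat := find (walk_len u v) (iota 0 #|T|).

Definition in_interval (u v x : T) : bool := dist u x + dist x v == dist u v.

Definition alpha1_metric : Prop :=
  forall u v w x : T, in_interval u w v -> in_interval v x w -> e v w ->
    dist u v + dist v x <= dist u x + 1.

Definition ecc (v : T) : nat := \max_(u : T) dist u v.
Definition rad : nat := \big[minn/#|T|]_(v : T) ecc v.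
Definition diam : nat := \max_(v : T) ecc v.
Definition center : {set T} := [set v | ecc v == rad].
Definition dist_set (v : T) (S : {set T}) : nat := \big[minn/#|T|]_(s in S) dist v s.
End Graph.

(* Main.v *)
(* Along a shortest path in an alpha_1-metric graph, once the distance to a fixed vertex
   has increased, it increases at every later edge except at most one ([rise]); hence balls
   are convex. Both cases of the first claim give
   diam(G) <= 2R - 4 with R = e(v). Suppose that no neighbor of v has a smaller
   eccentricity, and let F(w) be the set of vertices at distance >= R from w. For w a
   neighbor of v with d(., w) <= d(., v) on F(w) and |F(w)| minimal, u in F(w), y a neighbor of v
   towards u, and t in F(y) \ F(w) (which is nonempty by minimality), [rise] and d(t, u) <= 2R - 4
   force a pentagon v w a q y with a on the way to t and q on the way to u, and
   a second pentagon a a' m q' q glued along the edge aq, with a', m, q' on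
   a shortest path from t to u. Convexity of the balls makes this impossible.
   For the second claim, a vertex closest to v among those of smaller
   eccentricity is within distance 2 of v, which handles k = 1. *)
Require Import Defs.
From mathcomp Require Import all_boot zify.
Set Implicit Arguments. Unset Strict Implicit. Unset Printing Implicit Defensive.

Section Distance.
Context (T : finType) (e : rel T).
Hypotheses (e_simple : simple_graph e) (e_conn : connected_graph e).
Notation d := (dist e).

Ltac dlia :=
  repeat match goal with
  | H : is_true (e _ _) |- _ => clear H
  | H : is_true (~~ _) |- _ => clear H
  | H : forall _ : T, _ |- _ => clear H
  end; lia.

(** * Shortest-path distances and levels from a fixed vertex *)

Lemma edge_sym x y : e x y -> e y x.
Proof. by case: e_simple => sym _; rewrite sym. Qed.

Lemma walk_lenP x y n :
  reflect (exists p, [/\ size p = n, path e x p & last x p = y]) (walk_len e x y n).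
Proof.
apply: (iffP existsP) => [[p /andP[xp /eqP <-]]|[p [pn xp py]]].
  by exists p; rewrite size_tuple.
have pn' : size p == n by apply/eqP.
by exists (Tuple pn'); rewrite /= xp py eqxx.
Qed.

Lemma dist_le_walk x y n : walk_len e x y n -> d x y <= n.
Proof.
move=> xyn; case: (leqP (d x y) n) => // lt_nd.
have n_lt : n < #|T|.
  by rewrite (leq_trans lt_nd) // (leq_trans (find_size _ _)) ?size_iota.
by have := before_find 0 lt_nd; rewrite nth_iota // add0n xyn.
Qed.

Lemma dist_walk x y : walk_len e x y (d x y).
Proof.
have has_xy : has (walk_len e x y) (iota 0 #|T|).
  (* A duplicate-free path has fewer than [#|T|] edges, so [find] searches far enough. *)
  case/connectP: (e_conn x y) => p /shortenP[q xq q_uniq _] y_last.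
  apply/hasP; exists (size q); last by apply/walk_lenP; exists q.
  by rewrite mem_iota add0n leq0n /=; have := max_card [in x :: q]; rewrite (card_uniqP q_uniq).
have := nth_find 0 has_xy; rewrite nth_iota ?add0n //.
by rewrite -[X in _ < X](size_iota 0) -has_find.
Qed.

Lemma dist_le_card x y : d x y <= #|T|.
Proof. by rewrite (leq_trans (find_size _ _)) ?size_iota. Qed.

Lemma dist_tri x y z : d x z <= d x y + d y z.
Proof.
case/walk_lenP: (dist_walk x y) => p [<- xp py].
case/walk_lenP: (dist_walk y z) => q [<- yq qz].
apply/dist_le_walk/walk_lenP; exists (p ++ q).
by rewrite size_cat cat_path last_cat xp py.
Qed.

Lemma dist_sym_le x y : d x y <= d y x.
Proof.
case/walk_lenP: (dist_walk y x) => p [<- yp px].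
apply/dist_le_walk/walk_lenP; exists (rev (belast y p)); split.
- by rewrite size_rev size_belast.
- rewrite -px rev_path (eq_path (e' := e)) // => a b /=.
  by case: e_simple => ->.
- by case: p {yp} px => //= z p _; rewrite rev_cons last_rcons.
Qed.

Lemma dist_sym x y : d x y = d y x.
Proof. by apply/eqP; rewrite eqn_leq !dist_sym_le. Qed.

Lemma dist_le_ecc x y : d x y <= ecc e x.
Proof. by rewrite dist_sym; apply: (leq_bigmax (F := fun z => d z x)). Qed.

Lemma ecc_attained x : exists y, d x y = ecc e x.
Proof.
have /(eq_bigmax (fun z => d z x)) [y xy] : 0 < #|T| by apply/card_gt0P; exists x.
by exists y; rewrite dist_sym /ecc xy.
Qed.

Lemma dist_eq0 x y : d x y = 0 -> x = y.
Proof. move=> xy0; have := dist_walk x y; rewrite xy0.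
by case/walk_lenP => p [/eqP]; rewrite size_eq0 => /eqP ->.
Qed.

Lemma dist_edge x y : e x y -> d x y <= 1.
Proof. by move=> xy; apply/dist_le_walk/walk_lenP; exists [:: y]; rewrite /= xy. Qed.

Lemma dist_eq1 x y : d x y = 1 -> e x y.
Proof. move=> xy1; have := dist_walk x y; rewrite xy1.
by case/walk_lenP => -[|z [|? ?]] [//= _]; rewrite andbT => xz <-. Qed.

Lemma level_edge u x y : e x y -> d u x <= d u y + 1 /\ d u y <= d u x + 1.
Proof.
move=> xy; have := dist_edge xy; have := dist_tri u x y; have := dist_tri u y x.
by rewrite (dist_sym y x); dlia.
Qed.

Lemma level_neq u x y : d u x <> d u y -> x != y.
Proof. by move=> xy; apply/eqP => x_y; rewrite x_y in xy. Qed.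

Lemma next_step u x : 0 < d u x -> exists2 y, e x y & d u y + 1 = d u x.
Proof.
move=> ux_gt0; have: exists2 y, e x y & d y u < d x u.
  rewrite (dist_sym u x) in ux_gt0.
  case/walk_lenP: (dist_walk x u) ux_gt0 => -[|y p] [<- //= /andP[xy yp] pu] _.
  by exists y => //; rewrite ltnS; apply/dist_le_walk/walk_lenP; exists p.
case=> y xy; rewrite dist_sym (dist_sym x) => lt_y; exists y => //.
by have := level_edge u xy; dlia.
Qed.

Lemma dist_le2 x z y : e x z -> e z y -> d x y <= 2.
Proof. by move=> xz zy; have := dist_tri x z y; have := dist_edge xz; have := dist_edge zy; dlia. Qed.

Lemma dist_ge2 x y : x != y -> ~~ e x y -> 2 <= d x y.
Proof.
move=> xNy Nexy; case xyd: (d x y) => [|[|//]]; first by rewrite (dist_eq0 xyd) eqxx in xNy.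
by rewrite (dist_eq1 xyd) in Nexy.
Qed.

Lemma midpoint x y : d x y = 2 -> exists2 z, e x z & e z y.
Proof.
move=> xy2; have [|z yz xz] := @next_step x y; first by rewrite xy2.
by exists z; [apply: dist_eq1; dlia | apply: edge_sym].
Qed.

(** * Convex balls, triangles and pentagons *)

Section Alpha1.
Hypothesis alpha : alpha1_metric e.

(* After its first climb, a shortest path climbs at every later edge except at most one. *)
Lemma rise u a b x :
  e a b -> d u b = d u a + 1 -> d a x = d b x + 1 -> d u a + d a x <= d u x + 1.
Proof.
move=> ab ub ax.
have ab1 : d a b = 1 by have := dist_edge ab; have := dist_tri u a b; dlia.
by apply: (alpha (w := b)) => //; rewrite /in_interval; dlia.
Qed.

(** If [z] were at level k+1, [x] would be at level k, and [rise] along x, z, y would put [y] above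
    level k. *)
Lemma midpoint_convex u x z y k :
  e x z -> e z y -> d x y = 2 -> d u x <= k -> d u y <= k -> d u z <= k.
Proof.
move=> xz zy xy2 ux uy; case: (leqP (d u z) k) => // uz.
have zy1 : d z y = 1.
  by have := dist_edge zy; have := dist_edge xz; have := dist_tri x z y; dlia.
have := level_edge u xz; have := @rise u x z y xz; dlia.
Qed.

(** Otherwise [v] is a midpoint of [a] and [b] outside a ball around [u] that contains both. *)
Lemma gate_clique u v a b : e v a -> e v b -> d u a + 1 = d u v -> d u b + 1 = d u v ->
  a != b -> e a b.
Proof.
move=> va vb ua ub aNb; apply: contraT => Nab.
have := dist_le2 (edge_sym va) vb; have := dist_ge2 aNb Nab => ? ?.
have := @midpoint_convex u a v b (d u a) (edge_sym va) vb; dlia.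
Qed.

(* If [a] is a neighbor of [w] towards [u], then [rise] bounds first d(a, y) and then
   d(y1, a) by 2, and convexity of the ball around [y1] gives d(y1, w) <= 2. *)
Lemma triangle_or_pentagon u v w y y1 :
  e v w -> e v y -> e y y1 -> d u v = d u w -> d u y + 1 = d u v -> d u y1 + 1 = d u y ->
  (exists g, [/\ e v g, e w g & d u g + 1 = d u v]) \/ (exists2 a, e w a & e a y1).
Proof.
move=> vw vy yy1 uvw uy uy1.
have [|a wa ua] := @next_step u w; first by dlia.
have [va|Nva] := boolP (e v a); first by left; exists a; split=> //; dlia.
right; have aNv : v != a by apply: (level_neq (u := u)); dlia.
have va2 : d v a = 2 by have := dist_le2 vw wa; have := dist_ge2 aNv Nva; dlia.
have ya2 : d a y <= 2.
  have := @rise u a w y (edge_sym wa).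
  have := dist_tri a v y; have := dist_edge vy; have := dist_sym a v.
  have := dist_le2 (edge_sym vw) vy; have := dist_tri a w y; have := dist_edge (edge_sym wa).
  by dlia.
have y1a : d y1 a <= 2.
  have := @rise u y1 y a (edge_sym yy1); have := dist_tri y1 y a.
  by have := dist_edge (edge_sym yy1); have := dist_sym a y; dlia.
have y1v := dist_le2 (edge_sym yy1) (edge_sym vy).
have y1w := midpoint_convex vw wa va2 y1v y1a.
have [|z wz zy1] := @midpoint w y1; last by exists z.
by have := dist_tri u y1 w; have := dist_sym w y1; dlia.
Qed.

(* Walking from [a] towards [t], the sum of the distances to [t] and [u] drops by
   one at some flat edge; triangles slide that edge back to [a]. *)
Lemma slide t u a q :
  e a q -> d t q = d t a + 1 -> d u a = d u q + 1 -> d t u = d t a + d u q ->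
  exists f, [/\ e a f, d u f = d u a & d t f + 1 = d t a].
Proof.
move ta: (d t a) => n; elim: n => [|n IHn] in a q ta *.
  move=> aq tq uq tu; have := dist_eq0 ta => ta'; subst a.
  by have := dist_sym t u; dlia.
move=> aq tq ua tu; have [|a' aa' ta'] := @next_step t a; first by dlia.
have [ua'|ua'] : d u a' = d u a \/ d u a' = d u a + 1.
- by have := level_edge u aa'; have := dist_tri t a' u; have := dist_sym u a'; dlia.
- by exists a'; split=> //; dlia.
have a'a := edge_sym aa'.
(* The edge [a'a] satisfies the hypotheses on [aq], one step closer to [t]. *)
have [||||f [a'f uf tf]] := IHn a' a _ a'a; try dlia.
have [|||[g [a'g fg ug]]|[b fb bq]] := @triangle_or_pentagon u _ _ _ _ a'f a'a aq; try dlia.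
- have tg : d t g = n.
    have := level_edge t fg; have := dist_tri t g u; have := dist_sym g u; dlia.
  exists g; split; try dlia.
  apply: (@gate_clique u a'); [exact: edge_sym|by []|dlia|dlia|].
  by apply: (level_neq (u := t)); dlia.
(* [f] and [q] differ by three levels from [t], yet [b] would join them by two edges. *)
- by have := level_edge t fb; have := level_edge t bq; dlia.
Qed.

(** * The double pentagon configuration *)

Lemma level_two u x z y : e x z -> e z y -> d u x = d u y + 2 -> d x y = 2.
Proof.
move=> xz zy ux; have := dist_le2 xz zy; have := dist_tri u y x; have := dist_sym x y; dlia.
Qed.

(* The midpoint [s2] of [s] and [m] stays within distance 2 of [a], hence of [w], and [m]
   lies between [a'] and [s2]. *)
Lemma opposite_vertex_close t v w a a' m s R :
  e v w -> e w a -> e a a' -> e a' m -> e v s -> d s m <= 2 ->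
  d t v = R -> d t s = R -> d t a + 2 = R -> d t a' + 3 = R -> d t m + 2 = R ->
  d v m = 3 -> d w m <= 2.
Proof.
move=> vw wa aa' a'm vs sm tv ts ta ta' tm vm.
have va2 : d v a = 2 by apply: (level_two vw wa (u := t)); dlia.
have sm2 : d s m = 2 by have := dist_tri t m s; have := dist_sym s m; dlia.
have [s2 ss2 s2m] := midpoint sm2.
have ms : d a s <= 2.
  have := @rise m s v a (edge_sym vs); have := dist_tri s v a.
  have := dist_edge (edge_sym vs); have := dist_sym a s; have := dist_sym m s.
  by have := dist_sym m v; have := dist_le2 (edge_sym a'm) (edge_sym aa'); dlia.
have as2 := midpoint_convex ss2 s2m sm2 ms (dist_le2 aa' a'm).
have s2v : d s2 v <= 2 := dist_le2 (edge_sym ss2) (edge_sym vs).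
have ws2 : d s2 w <= 2 by apply: midpoint_convex vw wa va2 s2v _; rewrite dist_sym.
have a's2 : d a' s2 = 2.
  have := dist_le2 a'm (edge_sym s2m); have := level_edge t ss2.
  by have := dist_tri t a' s2; dlia.
apply: midpoint_convex a'm (edge_sym s2m) a's2 (dist_le2 wa aa') _.
by rewrite dist_sym.
Qed.

(** A midpoint of [v] and [m] would be closer than [v] to both [t] and [u], hence adjacent to [w]:
    an excluded [g]. *)
Lemma apex_gap t u v w m R :
  e v w -> d t v = R -> d u v = R -> d t w + 1 = R -> d u w = R ->
  d t m + 2 = R -> d u m + 2 = R ->
  (forall g, e v g -> e w g -> d u g + 1 <> R) -> 2 < d v m.
Proof.
move=> vw tv uv tw uw tm um no_g.
have [//|vm_le] := ltnP 2 (d v m).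
have [|s vs sm] := @midpoint v m.
  by have := dist_tri t m v; have := dist_sym v m; dlia.
have [tvs tsm] := (level_edge t vs, level_edge t sm).
have [uvs usm] := (level_edge u vs, level_edge u sm).
have sNw : w != s by apply: (level_neq (u := u)); dlia.
have ws : e w s by apply: (@gate_clique t v) => //; dlia.
by case: (no_g s) => //; dlia.
Qed.

(** [v] is a midpoint of [w] and [y], so convexity puts it within 2 of [m], against [apex_gap]. *)
Lemma apex_far t u v w y m R :
  e v w -> e v y -> d t v = R -> d u v = R -> d t w + 1 = R -> d u w = R ->
  d t y = R -> d u y + 1 = R -> d t m + 2 = R -> d u m + 2 = R ->
  (forall g, e v g -> e w g -> d u g + 1 <> R) ->
  d w m <= 2 -> d y m <= 2 -> False.
Proof.
move=> vw vy tv uv tw uw ty uy tm um no_g wm ym.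
have := apex_gap vw tv uv tw uw tm um no_g; rewrite ltnNge => /negP; apply.
have wNy : w != y by apply: (level_neq (u := t)); dlia.
have Nwy : ~~ e w y by apply/negP => wy; apply: (no_g y).
have wy2 : d w y = 2 by have := dist_le2 (edge_sym vw) vy; have := dist_ge2 wNy Nwy; dlia.
by rewrite dist_sym; apply: midpoint_convex (edge_sym vw) vy wy2 _ _; rewrite dist_sym.
Qed.

(* Two pentagons v w a q y and a a' m q' q share the edge aq, with [t] behind [a'] and
   [u] behind [q']. *)
Lemma no_double_pentagon t u v w y a q a' q' m R :
  e v w -> e v y -> e w a -> e y q -> e a a' -> e a' m -> e q q' -> e q' m ->
  d t v = R -> d u v = R -> d t w + 1 = R -> d u w = R -> d t y = R -> d u y + 1 = R ->
  d t a + 2 = R -> d u q + 2 = R -> d t a' + 3 = R -> d u q' + 3 = R ->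
  d t q' + 1 = R -> d t m + 2 = R -> d u m + 2 = R ->
  (forall g, e v g -> e w g -> d u g + 1 <> R) -> False.
Proof.
move=> vw vy wa yq aa' a'm qq' q'm tv uv tw uw ty uy ta uq ta' uq' tq' tm um no_g.
have far := apex_far vw vy tv uv tw uw ty uy tm um no_g.
have a'q' : d a' q' = 2.
  by have := dist_le2 a'm (edge_sym q'm); have := dist_tri t a' q'; dlia.
have va' : d v a' <= 3.
  by have := dist_tri v w a'; have := dist_le2 wa aa'; have := dist_edge vw; dlia.
have vq' : d v q' <= 3.
  by have := dist_tri v y q'; have := dist_le2 yq qq'; have := dist_edge vy; dlia.
have vm := midpoint_convex a'm (edge_sym q'm) a'q' va' vq'.
have vm3 : d v m = 3 by have := apex_gap vw tv uv tw uw tm um no_g; dlia.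
have closew s : e v s -> d s m <= 2 -> d t s = R -> d w m <= 2.
  move=> vs sm ts; exact: (opposite_vertex_close vw wa aa' a'm vs sm tv ts ta ta' tm vm3).
have closey s : e v s -> d s m <= 2 -> d u s = R -> d y m <= 2.
  move=> vs sm us; exact: (opposite_vertex_close vy yq qq' q'm vs sm uv us uq uq' um vm3).
(* If [s] keeps level R from [t] or [u], both [w] and [y] come within 2 of [m]; otherwise [s] is an
   excluded [g]. *)
have [|s vs ms] := @next_step m v; first by rewrite dist_sym vm3.
have sm : d s m <= 2 by rewrite dist_sym; have := dist_sym m v; dlia.
have [tvs uvs] := (level_edge t vs, level_edge u vs).
have [tms ums] := (dist_tri t m s, dist_tri u m s).
have ms' := dist_sym m s.
have [ts|ts] : d t s = R \/ d t s + 1 = R by dlia.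
- have wm := closew s vs sm ts.
  by apply: far => //; apply: (closey w).
have [us|us] : d u s = R \/ d u s + 1 = R by dlia.
- have ym := closey s vs sm us.
  by apply: far => //; apply: (closew y).
have sNw : w != s by apply: (level_neq (u := u)); dlia.
have ws : e w s by apply: (@gate_clique t v) => //; dlia.
exact: (no_g s).
Qed.

(** At the start of an edge leaving [t] and approaching [u], [rise] bounds the sum of the two levels
    by d(t,u)+1 <= 2R-3. *)
Lemma far_pair_separated t u v w y R :
  e v w -> e v y -> d t u + 4 <= 2 * R -> d t v = R -> d u v = R -> d t w + 1 = R -> d u w = R ->
  d t y = R -> d u y + 1 = R -> (forall g, e v g -> e w g -> d u g + 1 <> R) -> False.
Proof.
move=> vw vy tu tv uv tw uw ty uy no_g.
have ut := dist_sym u t; have Rt x := dist_sym x t; have Ru x := dist_sym x u.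
have R4 : 2 <= R by dlia.
have towards_u y' : e v y' -> d u y' + 1 = R -> d t y' = R.
  move=> vy' uy'; have := level_edge t vy'.
  have [ty'|] : d t y' + 1 = R \/ d t y' + 1 <> R by dlia.
    case: (no_g y') => //; apply: (@gate_clique t v) => //; try dlia.
    by apply: (level_neq (u := u)); dlia.
  have := @rise t v y' u vy'; have := Ru v; have := Ru y'; dlia.
have [|a wa ta] := @next_step t w; first by dlia.
have ua : d u a + 1 = R.
  have [//|uaN] : d u a + 1 = R \/ d u a + 1 <> R by dlia.
  have uwa := level_edge u wa.
  have [ua|ua] : d u a = R + 1 \/ d u a = R by dlia.
    by have := @rise u w a t wa; have := Rt w; have := Rt a; dlia.
  (* With [a] at level R from [u], either outcome violates that bound or [towards_u]. *)
  have [|||[g [vg yg tg]]|[b yb ba]] := @triangle_or_pentagon t v y w a vy vw wa; try dlia.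
    have [ug|ug] : d u g = R \/ d u g + 1 = R.
    - by have := level_edge u vg; have := level_edge u yg; dlia.
    - have := @rise t g y u (edge_sym yg); have := Ru g; have := Ru y; dlia.
    by have := towards_u g vg ug; dlia.
  have [tyb tba] := (level_edge t yb, level_edge t ba).
  have [ub|ub] : d u b = R \/ d u b + 1 = R.
  - by have := level_edge u yb; have := level_edge u ba; dlia.
  - have := @rise t b y u (edge_sym yb); have := Ru b; have := Ru y; dlia.
  by have := @rise t a b u (edge_sym ba); have := Ru a; have := Ru b; dlia.
have [|q aq uq] := @next_step u a; first by dlia.
(* [no_g] excludes the triangle; the pentagon brings its own neighbor [y'] of [v], which replaces
   [y]. *)
have [|||[g [wg vg ug]]|[y' vy' y'q]] := @triangle_or_pentagon u w v a q (edge_sym vw) wa aq; try dlia.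
  by case: (no_g g) => //; dlia.
have uy' : d u y' + 1 = R by have := level_edge u vy'; have := level_edge u y'q; dlia.
have ty' := towards_u y' vy' uy'.
have tq : d t q + 1 = R by have := level_edge t aq; have := level_edge t y'q; dlia.
(* The edge [aq] attains the bound, giving the equality that [slide] requires. *)
have tu_eq : d t u + 4 = 2 * R.
  by have := @rise t a q u aq; have := Ru a; have := Ru q; dlia.
have [|||a' [aa' ua' ta']] := @slide t u a q aq; try (have := Ru q; dlia).
have [|q' qq' uq'] := @next_step u q; first by have := level_edge u aa'; have := dist_tri t a' u; have := Ru a'; dlia.
have sum x : 2 * R <= d t x + d u x + 4 by have := dist_tri t x u; have := Ru x; dlia.
have [|||[m [am a'm um]]|[m a'm mq']] := @triangle_or_pentagon u a a' q q' aa' aq qq'; try dlia.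
  have [tm tam] := (level_edge t a'm, level_edge t am).
  have sm := sum m.
  have qm : e q m.
    apply: (@gate_clique u a) => //.
    by apply: (level_neq (u := t)); dlia.
  apply: (@apex_far t u v w y' m R) => //; try dlia.
  - exact: dist_le2 wa am.
  - exact: dist_le2 y'q qm.
have [tm um] := (level_edge t a'm, level_edge u a'm).
have [tmq umq] := (level_edge t mq', level_edge u mq').
have [sm sq'] := (sum m, sum q').
apply: (@no_double_pentagon t u v w y' a q a' q' m R) => //; try dlia.
exact: edge_sym.
Qed.

(** * Steps to smaller eccentricity *)

Lemma ecc_descent v : diam e + 4 <= 2 * ecc e v -> exists w, e v w /\ ecc e w < ecc e v.
Proof.
set R := ecc e v => diamR.
have d_diam x y : d x y <= diam e.
  by apply: leq_trans (dist_le_ecc x y) _; exact: leq_bigmax_cond.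
have ecc_at x : exists t, d t x = ecc e x.
  by have [t] := ecc_attained x; exists t; rewrite dist_sym.
have d_eccr x y : d x y <= ecc e y by rewrite dist_sym dist_le_ecc.
case: (boolP [exists w, e v w && (ecc e w < R)]) => [/existsP[w /andP[]]|].
  by move=> *; exists w.
rewrite negb_exists => /forallP no_w.
have ecc_nbr w : e v w -> R <= ecc e w.
  by move=> vw; have := no_w w; rewrite vw /= -leqNgt.
pose F x := [set t | R <= d t x].
pose P w := e v w && [forall t in F w, d t w <= d t v].
(* A climb from [v] to [y] seen from some [t] in [F y] would give 2R-1 <= d(t,u)+1. *)
have towardsP u y : d u v = R -> e v y -> d u y + 1 = R -> P y.
  move=> uv vy uy; rewrite /P vy; apply/forall_inP => t; rewrite inE => ty.
  have := level_edge t vy; have := @rise t v y u vy; have := d_diam t u.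
  by have := dist_sym v u; have := dist_sym y u; dlia.
have [u0 u0v] := ecc_at v; rewrite -/R in u0v.
have [|y0 vy0 u0y0] := @next_step u0 v; first by have := d_diam u0 v; dlia.
have Py0 : P y0 by apply: (towardsP u0) => //; dlia.
case: (arg_minnP (fun w => #|F w|) Py0) => w /andP[vw /forall_inP Fw] min_w.
have [u uw_ecc] := ecc_at w.
have uFw : u \in F w by rewrite inE uw_ecc ecc_nbr.
have ecc_w := ecc_nbr w vw.
have uwv := Fw u uFw; have uv_le : d u v <= R := d_eccr u v.
have [uw uv] : d u w = R /\ d u v = R by dlia.
(* [u] lies in [F w] but not in [F y], so minimality forbids [F y] inside [F w]. *)
have separate y : e v y -> d u y + 1 = R -> exists t, [/\ d t y = R, d t v = R & d t w + 1 = R].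
  move=> vy uy; have Py := towardsP u y uv vy uy.
  have /subsetPn[t ty tw] : ~~ (F y \subset F w).
    apply/negP => sub; have := min_w y Py; rewrite leqNgt => /negP; apply.
    apply/proper_card/properP; split=> //; exists u => //.
    by rewrite inE -ltnNge; dlia.
  case/andP: Py => _ /forall_inP/(_ t ty) tyv; exists t.
  move: ty tw; rewrite !inE -ltnNge => ty tw; have := d_eccr t v; rewrite -/R.
  have := level_edge t vw; have := level_edge t vy; split; dlia.
have no_g g : e v g -> e w g -> d u g + 1 <> R.
  move=> vg wg ug; have [t [tg tv tw]] := separate g vg ug.
  have := @rise t w g u wg; have := d_diam t u.
  by have := dist_sym w u; have := dist_sym g u; dlia.
have [|y vy uy] := @next_step u v; first by dlia.
have uy' : d u y + 1 = R by dlia.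
have [t [ty tv tw]] := separate y vy uy'.
case: (@far_pair_separated t u v w y R) => //.
by have := d_diam t u; dlia.
Qed.

(** If a closest [x] were at distance at least 3, its neighbor [w] towards [v] would have some [u]
    at distance e(v), with d(u,x) = e(v)-1; [rise] then gives d(u,v) > e(v). *)
Lemma lower_ecc_within2 v c : ecc e c < ecc e v -> exists2 x, d v x <= 2 & ecc e x < ecc e v.
Proof.
move=> lt_c; case: (arg_minnP (P := fun x => ecc e x < ecc e v) (d v) lt_c) => x lt_x min_x.
exists x => //; case: (leqP (d v x) 2) => // vx.
have [|w xw vw] := @next_step v x; first by dlia.
have ecc_w : ecc e v <= ecc e w.
  by case: (leqP (ecc e v) (ecc e w)) => // /min_x; dlia.
have [u wu] := ecc_attained w.
have [xu vu] := (dist_le_ecc x u, dist_le_ecc v u).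
have := @rise u x w v xw; have := level_edge u xw.
have := dist_sym u x; have := dist_sym u w; have := dist_sym u v.
by have := dist_sym x v; have := dist_sym w v; dlia.
Qed.

(** * Radius, diameter and distance to the center *)

Lemma bigmin_le (I : finType) (Q : pred I) (f : I -> nat) n i :
  Q i -> \big[minn/n]_(j | Q j) f j <= f i.
Proof.
move=> Qi; have := mem_index_enum i; elim: (index_enum I) => // j r IHr.
rewrite inE big_cons => /orP[/eqP <-|/IHr le_i]; first by rewrite Qi geq_minl.
by case: ifP => // _; rewrite geq_min le_i orbT.
Qed.

Lemma rad_le v : rad e <= ecc e v.
Proof. exact: bigmin_le. Qed.

Lemma center_exists (v : T) : exists c, ecc e c = rad e.
Proof.
case: (arg_minnP (P := predT) (ecc e) (isT : predT v)) => c _ min_c; exists c.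
apply/eqP; rewrite eqn_leq rad_le andbT; apply: (big_ind (leq (ecc e c))) => [|m n|x _]; last exact: min_c.
(* The default [#|T|] in [rad] is harmless: no eccentricity exceeds it. *)
- by apply/bigmax_leqP => y _; apply: dist_le_card.
- by rewrite leq_min => -> ->.
Qed.

Lemma diam_le_rad : diam e <= 2 * rad e.
Proof.
apply/bigmax_leqP => x _; apply/bigmax_leqP => y _; have [c <-] := center_exists x.
have [cx cy] := (dist_le_ecc c x, dist_le_ecc c y).
by have := dist_tri y c x; have := dist_sym y c; dlia.
Qed.

Lemma ecc_edge v w : e v w -> ecc e v <= ecc e w + 1.
Proof.
move=> vw; apply/bigmax_leqP => x _; rewrite dist_sym.
by have := dist_le_ecc w x; have := dist_tri v w x; have := dist_edge vw; dlia.
Qed.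

(** Both cases give diam + 4 <= 2e(v), the first through [diam_le_rad]. *)
Lemma ecc_descent_rad v :
  rad e + 1 < ecc e v \/ (ecc e v = rad e + 1 /\ diam e + 1 < 2 * rad e) ->
  exists w, e v w /\ ecc e w < ecc e v.
Proof. by move=> h; apply: ecc_descent; have := diam_le_rad; lia. Qed.

(** Each descent edge lowers the eccentricity by exactly one; only the last drop, from rad+1, may
    cost two edges. *)
Lemma center_near k v : ecc e v = rad e + k.+1 -> exists2 c, ecc e c = rad e & d v c <= k.+2.
Proof.
elim: k v => [|k IHk] v vk.
  have [c0 c0r] := center_exists v.
  have [|c vc cv] := @lower_ecc_within2 v c0; first by lia.
  by exists c => //; have := rad_le c; lia.
have [|w [vw wv]] := @ecc_descent_rad v; first by left; lia.
have [|c cr wc] := IHk w; first by have := ecc_edge vw; dlia.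
by exists c => //; have := dist_tri v w c; have := dist_edge vw; dlia.
Qed.

End Alpha1.
End Distance.

Theorem theorem6 (T : finType) (e : rel T) :
  simple_graph e -> connected_graph e -> alpha1_metric e ->
  forall v : T,
    ((rad e + 1 < ecc e v \/ (ecc e v = rad e + 1 /\ diam e + 1 < 2 * rad e)) ->
       exists w : T, e v w /\ ecc e w < ecc e v) /\
    (forall k : nat, 0 < k -> ecc e v = rad e + k ->
       dist_set e v (center e) <= k + 1).
Proof.
move=> e_simple e_conn alpha v; split; first exact: ecc_descent_rad.
case=> // k _ /(center_near e_simple e_conn alpha)[c cr vc].
rewrite addn1; apply: leq_trans vc; apply: bigmin_le.
by rewrite inE cr.
Qed.
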